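(* Let $\Gamma_1,\Gamma_2$ be non-trivial countable groups with $\Gamma_1$ infinite. Then $\Gamma_1*\Gamma_2\in\mathcal{H}_{\mathcal R}$. Moreover, if $\Sigma$ is a common finite subgroup of $\Gamma_1$ and $\Gamma_2$ such that $\Sigma$ is highly core-free in $\Gamma_1$ and either ($\Gamma_2$ is infinite and $\Sigma$ is highly core-free in $\Gamma_2$) or ($\Gamma_2$ is finite and $[\Gamma_2:\Sigma]\geq 2$), then the amalgamated free product $\Gamma_1\underset{\Sigma}{*}\Gamma_2$ belongs to $\mathcal{H}_{\mathcal R}$.
   Context: Graphs are simple and undirected: a vertex set $V$ with a symmetric irreflexive adjacency relation $\sim$. The Random Graph $\mathcal R$ is the unique (up to isomorphism) countably infinite graph such that for all disjoint finite sets $U,W$ of vertices there is a vertex $z\notin U\cup W$ adjacent to every vertex of $U$ and to no vertex of $W$. An action of a group $\Gamma$ on $\mathcal R$ is a homomorphism $\Gamma\to\mathrm{Aut}(\mathcal R)$. It is homogeneous if for every graph isomorphism $\varphi:U\to W$ between finite induced subgraphs of $\mathcal R$ there is $g\in\Gamma$ with $g u=\varphi(u)$ for all $u\in U$. $\mathcal H_{\mathcal R}$ denotes the class of all countable groups admitting a faithful and homogeneous action on $\mathcal R$. For a subgroup $\Sigma<\Gamma$ and a non-empty subset $S\subset\Gamma$, put $\mathrm{Core}_S(\Sigma)=\bigcap_{h\in S}h^{-1}\Sigma h$. The subgroup $\Sigma$ is highly core-free in $\Gamma$ if for every finite subset $F\subset\Gamma$, every $n\geq 1$ and all non-empty subsets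 $S_1,\dots,S_n\subset\Gamma$ with $\Gamma\setminus\Sigma F\subset\bigcup_{k=1}^n S_k$, there is $k\in\{1,\dots,n\}$ with $\mathrm{Core}_{S_k}(\Sigma)=\{1\}$. *)

(* Defs.v *)
From HB Require Import structures.
From mathcomp Require Import all_boot all_fingroup generic_quotient.
From mathcomp Require Import boolp classical_sets functions cardinality.

Set Implicit Arguments.
Unset Strict Implicit.
Unset Printing Implicit Defensive.

Local Open Scope classical_set_scope.
Local Open Scope card_scope.
Local Open Scope quotient_scope.
Local Open Scope group_scope.

Record graph := Graph {
  vertex :> Type;
  adj : vertex -> vertex -> Prop;
  adj_sym : forall u v, adj u v -> adj v u;
  adj_irrefl : forall v, ~ adj v v
}.

Arguments adj {g} u v.

(* These properties determine the graph up to isomorphism, so that being a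
   random graph is the same as being (a copy of) the random graph.          *)
Definition random_graph (R : graph) : Prop :=
  [set: R] #= [set: nat] /\
  forall U W : set R, finite_set U -> finite_set W -> U `&` W = set0 ->
    exists z : R, [/\ ~ (U `|` W) z,
      forall u, U u -> adj z u & forall w, W w -> ~ adj z w].

Definition automorphism (R : graph) (f : R -> R) : Prop :=
  bijective f /\ forall u v, adj (f u) (f v) <-> adj u v.

(* A homomorphism from G to Aut(R), in uncurried form. *)
Definition graph_action (G : groupType) (R : graph) (act : G -> R -> R) : Prop :=
  (forall g, automorphism (act g)) /\
  (forall g h, act (g * h) = act g \o act h).

Definition faithful_action (G : groupType) (R : graph) (act : G -> R -> R) : Prop :=
  injective act.

(* The isomorphism between the subgraphs induced on U and W is the restriction
   of phi to U; the values of phi outside U are irrelevant.                 *)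
Definition induced_iso (R : graph) (U W : set R) (phi : R -> R) : Prop :=
  set_bij U W phi /\
  forall u v, U u -> U v -> (adj (phi u) (phi v) <-> adj u v).

Definition homogeneous_action (G : groupType) (R : graph) (act : G -> R -> R) : Prop :=
  forall (U W : set R) (phi : R -> R), finite_set U -> finite_set W ->
    induced_iso U W phi -> exists g : G, forall u, U u -> act g u = phi u.

Definition in_HR (R : graph) (G : groupType) : Prop :=
  countable [set: G] /\
  exists act : G -> R -> R,
    [/\ graph_action act, faithful_action act & homogeneous_action act].

Definition core (G : groupType) (S Sigma : set G) : set G :=
  \bigcap_(h in S) [set h^-1 * s * h | s in Sigma].

Definition highly_core_free (G : groupType) (Sigma : set G) : Prop :=
  forall (F : set G) (n : nat) (S : 'I_n -> set G),
    finite_set F -> (1 <= n)%N -> (forall k, S k !=set0) ->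
    [set: G] `\` [set s * f | s in Sigma & f in F] `<=` \bigcup_k S k ->
    exists k, core (S k) Sigma = [set 1].

Definition left_cosets (G : groupType) (Sigma : set G) : set (set G) :=
  [set [set g * s | s in Sigma] | g in [set: G]].

Definition index_ge (n : nat) (G : groupType) (Sigma : set G) : Prop :=
  `I_n #<= left_cosets Sigma.

(* The quotient of the free product of G1 and G2 by the relations x = y for
   (x, y) in E, realized as words in the disjoint union of G1 and G2 modulo
   the congruence generated by the multiplication tables and E.             *)
Section GluedProduct.
Variables (G1 G2 : groupType) (E : set (G1 * G2)).

Local Notation word := (seq (G1 + G2)).

Inductive word_eq : word -> word -> Prop :=
| word_eq_refl w : word_eq w w
| word_eq_sym v w : word_eq v w -> word_eq w v
| word_eq_trans u v w : word_eq u v -> word_eq v w -> word_eq u w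
| word_eq_cat v v' w w' :
    word_eq v v' -> word_eq w w' -> word_eq (v ++ w) (v' ++ w')
| word_eq_one1 : word_eq [:: inl 1] [::]
| word_eq_one2 : word_eq [:: inr 1] [::]
| word_eq_mul1 (x y : G1) : word_eq [:: inl x; inl y] [:: inl (x * y)]
| word_eq_mul2 (x y : G2) : word_eq [:: inr x; inr y] [:: inr (x * y)]
| word_eq_glue (x : G1) (y : G2) : E (x, y) -> word_eq [:: inl x] [:: inr y].

Definition word_eqb (v w : word) : bool := `[< word_eq v w >].

Fact word_eqb_equiv : equiv_class_of word_eqb.
Proof.
split=> [w|v w|v u w].
- exact/asboolP/word_eq_refl.
- by apply/asboolP/asboolP; apply: word_eq_sym.
- by move=> /asboolP uv /asboolP vw; apply/asboolP; apply: word_eq_trans uv vw.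
Qed.

Canonical word_equiv := EquivRelPack word_eqb_equiv.

Definition glued_prod : Type := {eq_quot word_equiv}.

HB.instance Definition _ := Choice.on glued_prod.

Definition glued_class (w : word) : glued_prod := \pi_({eq_quot word_equiv}) w.
Definition glued_word (x : glued_prod) : word := repr (x : {eq_quot word_equiv}).

Definition word_inv (w : word) : word :=
  rev [seq match a with inl x => inl x^-1 | inr y => inr y^-1 end | a <- w].

Definition glued_mul (x y : glued_prod) := glued_class (glued_word x ++ glued_word y).
Definition glued_one := glued_class [::].
Definition glued_inv (x : glued_prod) := glued_class (word_inv (glued_word x)).

Lemma glued_wordK x : glued_class (glued_word x) = x.
Proof. exact: (@reprK _ {eq_quot word_equiv}). Qed.

Lemma glued_classP v w : glued_class v = glued_class w <-> word_eq v w.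
Proof. by split=> [/eqmodP/asboolP|/asboolP vw]; last exact/eqmodP. Qed.

Lemma glued_class_word w : word_eq (glued_word (glued_class w)) w.
Proof. by apply/glued_classP; rewrite glued_wordK. Qed.

Lemma glued_mulE v w :
  glued_mul (glued_class v) (glued_class w) = glued_class (v ++ w).
Proof. by apply/glued_classP; apply: word_eq_cat; apply: glued_class_word. Qed.

Lemma word_invl w : word_eq (word_inv w ++ w) [::].
Proof.
elim: w => [|a w IH]; first exact: word_eq_refl.
rewrite /word_inv map_cons rev_cons -/(word_inv w) -cats1 -catA.
apply: word_eq_trans IH; apply: word_eq_cat; first exact: word_eq_refl.
rewrite -[X in word_eq _ X]cat0s -[a :: w]cat1s catA.
apply: word_eq_cat (word_eq_refl _).
case: a => x.
  by apply: word_eq_trans (word_eq_mul1 _ _) _; rewrite mulVg; apply: word_eq_one1.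
by apply: word_eq_trans (word_eq_mul2 _ _) _; rewrite mulVg; apply: word_eq_one2.
Qed.

Lemma word_invK : involutive word_inv.
Proof.
move=> w; rewrite /word_inv map_rev revK -map_comp -[RHS]map_id.
by apply: eq_map => -[x|x] /=; rewrite invgK.
Qed.

Lemma word_invr w : word_eq (w ++ word_inv w) [::].
Proof. by rewrite -{1}[w]word_invK; apply: word_invl. Qed.

Fact glued_mulA : associative glued_mul.
Proof.
move=> x y z; rewrite -[x]glued_wordK -[y]glued_wordK -[z]glued_wordK.
by rewrite !glued_mulE catA.
Qed.

Fact glued_mul1g : left_id glued_one glued_mul.
Proof. by move=> x; rewrite -[x]glued_wordK glued_mulE. Qed.

Fact glued_mulg1 : right_id glued_one glued_mul.
Proof. by move=> x; rewrite -[x]glued_wordK glued_mulE cats0. Qed.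

Fact glued_mulVg : left_inverse glued_one glued_inv glued_mul.
Proof.
move=> x; rewrite -{2}[x]glued_wordK glued_mulE.
exact/glued_classP/word_invl.
Qed.

Fact glued_mulgV : right_inverse glued_one glued_inv glued_mul.
Proof.
move=> x; rewrite -{1}[x]glued_wordK glued_mulE.
exact/glued_classP/word_invr.
Qed.

HB.instance Definition _ := isGroup.Build glued_prod
  glued_mulA glued_mul1g glued_mulg1 glued_mulVg glued_mulgV.

End GluedProduct.

Definition free_product (G1 G2 : groupType) : groupType :=
  glued_prod (set0 : set (G1 * G2)).

(* Amalgamated free product of G1 and G2 over S, embedded in them by i1, i2. *)
Definition amalgamated_product (S G1 G2 : groupType)
    (i1 : {multiplicative S -> G1}) (i2 : {multiplicative S -> G2}) : groupType :=
  glued_prod [set (i1 s, i2 s) | s in [set: S]].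

(* Main.v *)
Require Import Defs.
From mathcomp Require Import all_boot all_fingroup.
From mathcomp Require Import boolp classical_sets functions cardinality.

Set Implicit Arguments.
Unset Strict Implicit.
Unset Printing Implicit Defensive.

Local Open Scope classical_set_scope.
Local Open Scope card_scope.
Local Open Scope group_scope.

(* Let G1 and G2 act freely on copies X and Y of the random graph such that
   every finite adjacency type over a finite set is realized by a vertex of a
   new orbit, and each orbit of G1 meets every neighbourhood in a finite set.
   A Sigma-equivariant isomorphism alpha : X -> Y makes the amalgam act on X,
   G2 acting through alpha; alpha is built by back and forth from finite
   partial isomorphisms, each of which can be extended in two ways.
   Homogeneity: given a finite partial isomorphism U -> W of X, choose g, g' in
   G1 such that the Sigma-orbits of g U and g' W are far from everything built
   so far, send g U to a copy A of U whose vertices lie in distinct new orbits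
   of Y, and send g' W to h A for some h in G2 outside Sigma; then g'^-1 h g
   maps U to W. For finite Sigma and infinite G1, being highly core-free means
   that g can be chosen with g^-1 Sigma g avoiding a given finite set of
   nontrivial elements, which is what makes g exist.
   Faithfulness: the trajectory of a vertex under a reduced word can be made to
   pass through new orbits at each step, so that it does not come back. *)

(** * Actions with the extension property *)

Section GroupMorphism.
Variables (S G : groupType) (i : S -> G).
Hypothesis iM : forall s t, i (s * t) = i s * i t.

Lemma morph_one : i 1 = 1.
Proof. by apply: (mulgI (i 1)); rewrite -iM !mulg1. Qed.

Lemma morph_inv s : i s^-1 = (i s)^-1.
Proof. by apply: (mulgI (i s)); rewrite -iM !mulgV morph_one. Qed.

End GroupMorphism.

(** The Rasiowa-Sikorski argument: stage [n] meets the requirement coded by [n], and stays put if no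
    requirement has that code. *)
Lemma dense_chain (I C : Type) (code : I -> nat) (le : C -> C -> Prop)
    (D : I -> C -> Prop) (c0 : C) :
  injective code -> (forall c, le c c) ->
  (forall a b c, le a b -> le b c -> le a c) ->
  (forall i c, exists2 d, le c d & D i d) ->
  exists2 c : nat -> C, forall m n, (m <= n)%N -> le (c m) (c n)
    & forall i, exists n, D i (c n).
Proof.
move=> code_inj le_refl le_trans dense.
have step : forall nc : nat * C, exists d,
    le nc.2 d /\ forall i, code i = nc.1 -> D i d.
  case=> n c /=; have [[i in_]|nin] := pselect (exists i, code i = n).
    have [d cd Did] := dense i c; exists d; split=> // j; rewrite -in_.
    by move=> /code_inj ->.
  by exists c; split=> // i in_; case: nin; exists i.
have [f fP] := choice step.
pose c := fix c n := if n is m.+1 then f (m, c m) else c0.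
exists c => [m n /subnK <-|i].
  by elim: (n - m)%N => [|k IH] //=; apply: le_trans IH _; case: (fP (k + m, c (k + m))%N).
by exists (code i).+1; case: (fP (code i, c (code i))) => _; apply.
Qed.

(* [ract_ext] prescribes the adjacency to [F] of the whole orbit of [z] and not
   only of [z]: this is what makes the property pass to subgroups. *)
Record random_action (G : groupType) (X : graph) (act : G -> X -> X) : Prop := {
  ractM : forall g h x, act (g * h) x = act g (act h x);
  ract_adj : forall g x y, adj (act g x) (act g y) <-> adj x y;
  ract_free : forall g x, act g x = x -> g = 1;
  ract_indep : forall g x, ~ adj (act g x) x;
  ract_ext : forall F T : set X, finite_set F -> finite_set T ->
    exists z, forall g f, F f ->
      act g z <> f /\ (adj (act g z) f <-> T (act g^-1 f));
  ract1 : forall x, act 1 x = x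
}.

Definition far (G : groupType) (X : graph) (act : G -> X -> X) (F : set X) (x : X) :=
  forall g f, F f -> act g x <> f /\ ~ adj (act g x) f.

Section RandomAction.
Variables (G : groupType) (X : graph) (act : G -> X -> X).
Hypothesis raX : random_action act.

Lemma ractVK g : cancel (act g) (act g^-1).
Proof. by move=> x; rewrite -(ractM raX) mulVg (ract1 raX). Qed.

Lemma ractKV g : cancel (act g^-1) (act g).
Proof. by move=> x; rewrite -(ractM raX) mulgV (ract1 raX). Qed.

Lemma ract_eqV g x y : act g x = y <-> act g^-1 y = x.
Proof. by split=> <-; rewrite (ractVK, ractKV). Qed.

Lemma ract_adjV g x y : adj (act g x) y <-> adj (act g^-1 y) x.
Proof.
by rewrite -(ract_adj raX g^-1) ractVK; split=> /adj_sym.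
Qed.

Lemma ract_inj g h x : act g x = act h x -> g = h.
Proof.
move=> e; have /(ract_free raX) : act (h^-1 * g) x = x.
  by rewrite (ractM raX) e ractVK.
by move/(canRL (mulKVg _)); rewrite mulg1.
Qed.

Lemma far_exists F : finite_set F -> exists z, far act F z.
Proof.
move=> Ffin; have [z zP] := ract_ext raX Ffin (finite_set0 X).
by exists z => g f Ff; have [zf zadj] := zP g f Ff; split=> // /zadj.
Qed.

Lemma random_action_res (S : groupType) (i : S -> G) :
  (forall s t, i (s * t) = i s * i t) -> injective i -> random_action (fun s => act (i s)).
Proof.
move=> iM i_inj; split=> [g h x|g x y|g x /(ract_free raX) e|g x|F T Ff Tf|x].
- by rewrite iM (ractM raX).
- exact: (ract_adj raX).
- by apply: i_inj; rewrite e morph_one.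
- exact: (ract_indep raX).
- have [z zP] := ract_ext raX Ff Tf; exists z => g f /(zP (i g)).
  by rewrite morph_inv.
- by rewrite morph_one // (ract1 raX).
Qed.

End RandomAction.

Lemma injective_unbounded (f : nat -> nat) (N : nat) :
  injective f -> exists k, (N <= f k)%N.
Proof.
move=> f_inj; apply: contrapT => H.
have : (size [seq f i | i <- iota 0 N.+1] <= size (iota 0 N))%N.
  apply: uniq_leq_size; first by rewrite map_inj_uniq ?iota_uniq.
  move=> _ /mapP[i _ ->]; rewrite mem_iota /= add0n ltnNge.
  by apply/negP => ?; apply: H; exists i.
by rewrite size_map !size_iota ltnn.
Qed.

Lemma finite_set_bound (T : Type) (f : T -> nat) (A : set T) :
  finite_set A -> exists N, forall x, A x -> (f x < N)%N.
Proof.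
move=> /(finite_image f)/finite_seqP[s sE].
exists (\max_(n <- s) n).+1 => x Ax; rewrite ltnS.
have : [set` s] (f x) by rewrite -sE; exists x.
by move=> /= fxs; apply: (@leq_bigmax_seq _ s xpredT id).
Qed.

(** * A random action built orbit by orbit *)

Section Construction.
Variables (G : groupType) (code : G -> nat).
Hypothesis code_inj : injective code.

(* Orbit [n] is joined to earlier orbits only, and [label n] lists the
   (codes of the) neighbours of [(1, n)] there. *)
Let label (n : nat) : seq (nat * nat) :=
  oapp fst [::] (@unpickle (seq (nat * nat) * nat)%type n).

(** The second component of the pickled pair is padding: varying it gives infinitely many codes of
    the same list [t]. *)
Lemma label_infinitely_often t N : exists2 n, (N <= n)%N & label n = t.
Proof.
have [|k Nk] := @injective_unbounded (fun k => pickle (t, k)) N.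
  by move=> k l /(pcan_inj pickleK)[].
by exists (pickle (t, k)); rewrite // /label pickleK.
Qed.

(** The group components enter only through the quotient [x.1^-1 * y.1], which makes the relation
    invariant under left translation. *)
Definition orbit_arrow (x y : G * nat) : Prop :=
  (y.2 < x.2)%N /\ (code (x.1^-1 * y.1), y.2) \in label x.2.

Definition orbit_adj x y := orbit_arrow x y \/ orbit_arrow y x.

Lemma orbit_adj_sym x y : orbit_adj x y -> orbit_adj y x.
Proof. by case; [right|left]. Qed.

Lemma orbit_adj_irrefl x : ~ orbit_adj x x.
Proof. by case=> -[]; rewrite ltnn. Qed.

Definition orbit_graph := Graph orbit_adj_sym orbit_adj_irrefl.

Definition translation (g : G) (x : orbit_graph) : orbit_graph := (g * x.1, x.2).

Lemma translation_random_action : random_action translation.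
Proof.
split.
- by move=> g h x; rewrite /translation /= mulgA.
- have arr g x y : orbit_arrow (translation g x) (translation g y) <-> orbit_arrow x y.
    by rewrite /orbit_arrow /= invgM -mulgA mulKg.
  by move=> g x y; split=> -[/arr ?|/arr ?]; by [left|right].
- by move=> g [x n] [] /(canRL (mulgK _)); rewrite mulgV.
- by move=> g x; case=> -[] /=; rewrite ltnn.
- move=> F T Ff Tf.
  have [N FN] := finite_set_bound snd Ff; have [M TM] := finite_set_bound snd Tf.
  have := finite_image (fun x : orbit_graph => (code x.1, x.2)) Tf.
  move=> /finite_seqP[t tE].
  (* An orbit later than those of [F] can be joined to [F] only by arrows leaving it, and its label
     lists exactly the points of [T]. *)
  have [n Nn tn] := label_infinitely_often t (maxn N M).
  exists (1, n) => g f Ff'; have fn : (f.2 < n)%N.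
    by apply: leq_trans (FN _ Ff') (leq_trans (leq_maxl _ _) Nn).
  split; first by move=> fE; rewrite -fE /= ltnn in fn.
  split=> [[[_ /=]|[/=]]|Tgf].
  + rewrite mulg1 tn => ft; have : [set` t] (code (g^-1 * f.1), f.2) by [].
    by rewrite -tE => -[[x m] Tx [/code_inj xE mE]]; rewrite /translation -xE -mE.
  + by rewrite ltnNge ltnW.
  + left; split=> //=; rewrite mulg1 tn.
    suff : [set` t] (code (g^-1 * f.1), f.2) by [].
    by rewrite -tE; exists (translation g^-1 f).
- by move=> [x n]; rewrite /translation mul1g.
Qed.

(** A label is a finite list and [code] is injective, so only finitely many [g] give a quotient
    listed in the label of [u.2] or [v.2]. *)
Lemma translation_locally_finite (u v : orbit_graph) :
  finite_set [set g | adj (translation g u) v].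
Proof.
pose s n : set nat := [set` unzip1 (label n)].
have sfin n : finite_set (s n) by apply/finite_seqP; exists (unzip1 (label n)).
apply: (@sub_finite_set _ _ ((fun g => code ((g * u.1)^-1 * v.1)) @^-1` s u.2 `|`
  (fun g => code (v.1^-1 * (g * u.1))) @^-1` s v.2)).
  move=> g [[_ /= h]|[_ /= h]]; [left|right].
    by apply/mapP; exists (code ((g * u.1)^-1 * v.1), v.2).
  by apply/mapP; exists (code (v.1^-1 * (g * u.1)), u.2).
rewrite finite_setU; split; apply: finite_preimage => // g h _ _ /code_inj.
  by move=> /mulIg/invg_inj/mulIg.
by move=> /mulgI/mulIg.
Qed.

End Construction.

(** * Back and forth *)

(** Only [r] is translated: by invariance, translates of both pairs reduce to this case. The
    equality part makes the induced map of orbits well defined and injective. *)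
Definition compatible (S : groupType) (X Y : graph) (aX : S -> X -> X)
    (aY : S -> Y -> Y) (r r' : X * Y) : Prop :=
  forall s, (aX s r.1 = r'.1 <-> aY s r.2 = r'.2) /\
            (adj (aX s r.1) r'.1 <-> adj (aY s r.2) r'.2).

(* [p] generates, by closing under the action of [S], the graph of a finite
   [S]-equivariant partial isomorphism. *)
Definition partial_iso (S : groupType) (X Y : graph) (aX : S -> X -> X)
    (aY : S -> Y -> Y) (p : set (X * Y)) : Prop :=
  finite_set p /\ forall r r', p r -> p r' -> compatible aX aY r r'.

Definition converse (A B : Type) (p : set (A * B)) : set (B * A) :=
  [set r | p (r.2, r.1)].

Lemma partial_iso_converse (S : groupType) (X Y : graph) (aX : S -> X -> X)
    (aY : S -> Y -> Y) (p : set (X * Y)) :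
  partial_iso aX aY p -> partial_iso aY aX (converse p).
Proof.
move=> [pfin pc]; split.
  have := finite_image (fun r => (r.2, r.1)) pfin; apply: sub_finite_set.
  by move=> [y x] pxy; exists (x, y).
move=> [y x] [y' x'] pr pr' s; have [e a] := pc _ _ pr pr' s.
by split; [apply: iff_sym e|apply: iff_sym a].
Qed.

Section PartialIso.
Variables (S : groupType) (X Y : graph) (aX : S -> X -> X) (aY : S -> Y -> Y).
Hypotheses (raX : random_action aX) (raY : random_action aY).

Lemma compatible_sym r r' : compatible aX aY r r' -> compatible aX aY r' r.
Proof.
move=> c s; have [e a] := c s^-1; split.
  exact: iff_trans (ract_eqV raX _ _ _) (iff_trans e (iff_sym (ract_eqV raY _ _ _))).
exact: iff_trans (ract_adjV raX _ _ _) (iff_trans a (iff_sym (ract_adjV raY _ _ _))).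
Qed.

Lemma compatible_refl r : compatible aX aY r r.
Proof.
move=> s; split; last by split=> [/(ract_indep raX)|/(ract_indep raY)].
split=> [/(ract_free raX)->|/(ract_free raY)->].
  exact: ract1 raY _.
exact: ract1 raX _.
Qed.

Lemma partial_iso_insert p x y : partial_iso aX aY p ->
  (forall r, p r -> compatible aX aY (x, y) r) ->
  partial_iso aX aY ((x, y) |` p).
Proof.
move=> [pfin pc] c; split; first by rewrite finite_setU; split.
move=> r r' [->|pr] [->|pr']; last exact: pc.
- exact: compatible_refl.
- exact: c.
- exact/compatible_sym/c.
Qed.

(** Farness makes every equality and adjacency between the new pair and [p] false, on both sides. *)
Lemma partial_iso_insert_far p x y : partial_iso aX aY p ->
  far aX (fst @` p) x -> far aY (snd @` p) y ->
  partial_iso aX aY ((x, y) |` p).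
Proof.
move=> pp farx fary; apply: partial_iso_insert pp _ => r pr s.
have [? ?] := farx s r.1 (ex_intro2 _ _ r pr erefl).
by have [? ?] := fary s r.2 (ex_intro2 _ _ r pr erefl).
Qed.

Lemma partial_iso_forth p x : finite_set [set: S] -> partial_iso aX aY p ->
  exists y, partial_iso aX aY ((x, y) |` p).
Proof.
move=> Sfin pp; have [pfin pc] := pp.
(* If [x] lies in an orbit already matched, equivariance forces its image; otherwise the image is
   taken in a new orbit. *)
have [[r [s [pr sr]]]|xnew] := pselect (exists r s, p r /\ aX s r.1 = x).
  exists (aY s r.2); apply: partial_iso_insert pp _ => r' pr' t /=.
  by rewrite -sr -(ractM raX) -(ractM raY); apply: pc.
(* [T] carries the neighbours of [x] in the matched orbits over to [Y]; it is finite because [S] and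
   [p] are. *)
pose T := [set y | exists r s, [/\ p r, adj x (aX s r.1) & y = aY s r.2]].
have Tfin : finite_set T.
  apply: sub_finite_set (finite_image2 (fun s r => aY s r.2) Sfin pfin).
  by move=> y [r [s [pr _ ->]]]; exists s => //; exists r.
have [y yP] := ract_ext raY (finite_image snd pfin) Tfin.
exists y; apply: partial_iso_insert pp _ => r pr s /=.
have [yr yadj] := yP s r.2 (ex_intro2 _ _ r pr erefl); split.
  split=> [sx|/yr//]; case: xnew; exists r, s^-1; split=> //.
  by rewrite -sx (ractVK raX).
split=> [sxr|/yadj[r' [s' [pr' xr' e]]]].
  apply/yadj; exists r, s^-1; split=> //.
  by move: sxr => /(ract_adjV raX)/adj_sym.
(* The neighbour in [T] may come from a pair other than [r]; compatibility within [p] carries the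
   coincidence in [Y] back to [X]. *)
have : aY (s * s') r'.2 = r.2.
  by rewrite (ractM raY) -e (ractKV raY).
move=> /(pc _ _ pr' pr _).1 e'; apply/(ract_adjV raX).
by rewrite -e' (ractM raX) (ractVK raX); apply/adj_sym.
Qed.

End PartialIso.

Lemma partial_iso_back (S : groupType) (X Y : graph) (aX : S -> X -> X)
    (aY : S -> Y -> Y) p y :
  random_action aX -> random_action aY ->
  finite_set [set: S] -> partial_iso aX aY p ->
  exists x, partial_iso aX aY ((x, y) |` p).
Proof.
move=> raX raY Sfin /partial_iso_converse pp.
have [x /partial_iso_converse] := partial_iso_forth raY raX y Sfin pp; exists x.
suff -> : (x, y) |` p = converse ((y, x) |` converse p) by [].
by apply/seteqP; split=> -[x' y'] /= [[-> ->]|]; by [left|right].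
Qed.

(** * Generic equivariant isomorphisms *)

Section GenericIso.
Variables (S : groupType) (X Y : graph) (aX : S -> X -> X) (aY : S -> Y -> Y).
Hypotheses (raX : random_action aX) (raY : random_action aY).
Hypotheses (Sfin : finite_set [set: S]).
Hypotheses (cntX : countable [set: X]) (cntY : countable [set: Y]).

Definition realizes (p : set (X * Y)) (alpha : X -> Y) (beta : Y -> X) : Prop :=
  forall x y, p (x, y) -> alpha x = y /\ beta y = x.

(** The conditions are the finite partial isomorphisms; the requirements are that each point of [X]
    and of [Y] be matched and that each [P i] be forced. The union of the chain is the
    isomorphism. *)
Lemma generic_iso (I : Type) (P : I -> (X -> Y) -> (Y -> X) -> Prop) :
  countable [set: I] ->
  (forall i p, partial_iso aX aY p -> exists q, [/\ p `<=` q,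
     partial_iso aX aY q & forall alpha beta, cancel alpha beta ->
       cancel beta alpha -> realizes q alpha beta -> P i alpha beta]) ->
  exists alpha beta, [/\ cancel alpha beta, cancel beta alpha,
    forall s x, alpha (aX s x) = aY s (alpha x),
    forall x x', adj (alpha x) (alpha x') <-> adj x x' &
    forall i, P i alpha beta].
Proof.
move=> /countable_injP[cI cI_inj] dense.
move/countable_injP: cntX => [cX cX_inj]; move/countable_injP: cntY => [cY cY_inj].
pose code (k : X + Y + I) : nat := pickle (match k with
  | inl (inl x) => inl (inl (cX x)) | inl (inr y) => inl (inr (cY y))
  | inr i => inr (cI i) end : nat + nat + nat).
have code_inj : injective code.
  move=> [[x|y]|i] [[x'|y']|i'] /(pcan_inj pickleK)// [].
  - by move=> /(cX_inj _ _ (in_setT _) (in_setT _)) ->.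
  - by move=> /(cY_inj _ _ (in_setT _) (in_setT _)) ->.
  - by move=> /(cI_inj _ _ (in_setT _) (in_setT _)) ->.
pose C := {p : set (X * Y) | partial_iso aX aY p}.
pose D (k : X + Y + I) (c : C) := match k with
  | inl (inl x) => exists y, sval c (x, y)
  | inl (inr y) => exists x, sval c (x, y)
  | inr i => forall alpha beta, cancel alpha beta -> cancel beta alpha ->
      realizes (sval c) alpha beta -> P i alpha beta end.
have p0 : partial_iso aX aY set0 by split.
have [|a b c ab bc|k [p pp]|c c_mono cD] := @dense_chain _ C code
  (fun a b => sval a `<=` sval b) D (exist _ _ p0) code_inj.
- by move=> c r.
- exact: subset_trans ab bc.
- case: k => [[x|y]|i].
  + have [y qq] := partial_iso_forth raX raY x Sfin pp.
    by exists (exist _ _ qq); [move=> r; right|exists y; left].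
  + have [x qq] := partial_iso_back y raX raY Sfin pp.
    by exists (exist _ _ qq); [move=> r; right|exists x; left].
  + by have [q [pq qq Pq]] := dense i p pp; exists (exist _ _ qq).
have [alpha alphaP] : {f : X -> Y & forall x, exists n, sval (c n) (x, f x)}.
  by apply: (@choice _ _ (fun x y =>
    exists n, sval (c n) (x, y))) => x; have [n [y ?]] := cD (inl (inl x)); exists y, n.
have [beta betaP] : {f : Y -> X & forall y, exists n, sval (c n) (f y, y)}.
  by apply: (@choice _ _ (fun y x =>
    exists n, sval (c n) (x, y))) => y; have [n [x ?]] := cD (inl (inr y)); exists x, n.
have compat m n r r' : sval (c m) r -> sval (c n) r' -> compatible aX aY r r'.
  move=> rm rn; have [_] := svalP (c (maxn m n)); apply.
    by apply: (c_mono m); rewrite ?leq_maxl.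
  by apply: (c_mono n); rewrite ?leq_maxr.
have fn m n x y x' y' : sval (c m) (x, y) -> sval (c n) (x', y') -> x = x' <-> y = y'.
  move=> h h'; have [] := compat _ _ _ _ h h' 1.
  by rewrite /= (ract1 raX) (ract1 raY).
have alphaE n x y : sval (c n) (x, y) -> alpha x = y.
  by move=> h; have [m h'] := alphaP x; apply/(fn _ _ _ _ _ _ h' h).
have betaE n x y : sval (c n) (x, y) -> beta y = x.
  by move=> h; have [m h'] := betaP y; apply/(fn _ _ _ _ _ _ h' h).
have alphaK : cancel alpha beta.
  by move=> x; have [n /betaE] := alphaP x.
have betaK : cancel beta alpha.
  by move=> y; have [n /alphaE] := betaP y.
exists alpha, beta; split=> //.
- move=> s x; have [m h] := alphaP x; have [n h'] := alphaP (aX s x).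
  by have [[/(_ erefl)]] := compat _ _ _ _ h h' s.
- move=> x x'; have [m h] := alphaP x; have [n h'] := alphaP x'.
  have [_ []] := compat _ _ _ _ h h' 1.
  by rewrite /= (ract1 raX) (ract1 raY).
- move=> i; have [n Dn] := cD (inr i); apply: Dn => // x y h.
  by split; [apply: alphaE h|apply: betaE h].
Qed.

End GenericIso.

(** * Reduced words *)

Section ReducedWords.
Variables (S G1 G2 : groupType) (E : set (G1 * G2)) (i1 : S -> G1) (i2 : S -> G2).
Hypotheses (i1M : forall s t, i1 (s * t) = i1 s * i1 t)
           (i2M : forall s t, i2 (s * t) = i2 s * i2 t).
Hypothesis E_glue : forall s, word_eq E [:: inl (i1 s)] [:: inr (i2 s)].

Local Notation word := (seq (G1 + G2)).
Local Notation weq := (word_eq E).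

Definition in_base (a : G1 + G2) : Prop :=
  match a with inl x => range i1 x | inr y => range i2 y end.

Definition is_left (a : G1 + G2) : bool := if a is inl _ then true else false.

Definition alternates (a b : G1 + G2) : bool := is_left a != is_left b.

Definition reduced (w : word) : Prop :=
  sorted alternates w /\ forall a, a \in w -> ~ in_base a.

(** Base elements, the identity among them, form a separate alternative because a reduced word
    contains no base letter. *)
Definition has_reduced_form (w : word) : Prop :=
  (exists s, weq w [:: inl (i1 s)]) \/
  exists w', [/\ w' <> [::], reduced w' & weq w w'].

Lemma word_eq_catl u v w : weq v w -> weq (u ++ v) (u ++ w).
Proof. exact: word_eq_cat (word_eq_refl _ _). Qed.

Lemma word_eq_catr u v w : weq v w -> weq (v ++ u) (w ++ u).
Proof. by move=> vw; apply: word_eq_cat vw (word_eq_refl _ _). Qed.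

Lemma has_reduced_form_eq v w : weq v w -> has_reduced_form w -> has_reduced_form v.
Proof.
move=> vw [[s ws]|[w' [w'0 w'r ww']]].
  by left; exists s; apply: word_eq_trans vw ws.
by right; exists w'; split=> //; apply: word_eq_trans vw ww'.
Qed.

Lemma path_alternates a b w :
  is_left a = is_left b -> path alternates a w = path alternates b w.
Proof. by case: w => //= c w ab; rewrite /alternates ab. Qed.

Lemma reduced_cons a w : reduced (a :: w) <->
  [/\ path alternates a w, ~ in_base a & reduced w].
Proof.
split=> [[/= aw nb]|[aw na [ws nb]]].
  split=> //; first by apply: nb; rewrite mem_head.
  split; first exact: path_sorted aw.
  by move=> b bw; apply: nb; rewrite in_cons bw orbT.
by split=> // b; rewrite in_cons => /orP[/eqP->|/nb].
Qed.

Lemma base_letter a : in_base a -> exists s, weq [:: a] [:: inl (i1 s)].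
Proof.
case: a => x [s _ <-]; exists s; first exact: word_eq_refl.
exact/word_eq_sym/E_glue.
Qed.

Lemma mul_letters a b : is_left a = is_left b ->
  exists c, is_left c = is_left a /\ weq [:: a; b] [:: c].
Proof.
case: a b => x [] y // _; [exists (inl (x * y))|exists (inr (x * y))].
  by split=> //; apply: word_eq_mul1.
by split=> //; apply: word_eq_mul2.
Qed.

(** The gluing relation moves the base letter to the side of [a], where it is multiplied in; the
    coset of [a] modulo the base is unchanged. *)
Lemma base_mul_letter s a : exists b, [/\ is_left b = is_left a,
  in_base b -> in_base a & weq [:: inl (i1 s); a] [:: b]].
Proof.
case: a => x.
  exists (inl (i1 s * x)); split=> //; last exact: word_eq_mul1.
  by move=> [t _ tE]; exists (s^-1 * t); rewrite // i1M morph_inv // tE mulKg.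
exists (inr (i2 s * x)); split=> //.
  by move=> [t _ tE]; exists (s^-1 * t); rewrite // i2M morph_inv // tE mulKg.
apply: word_eq_trans (word_eq_mul2 _ _ _).
exact: (word_eq_catr [:: inr x] (E_glue s)).
Qed.

(** A base letter in front is absorbed by the next letter, which stays on its side and outside the
    base. *)
Lemma has_reduced_form_cons a w : reduced w -> path alternates a w ->
  has_reduced_form (a :: w).
Proof.
move=> wr aw; have [ab|nab] := pselect (in_base a); last first.
  by right; exists (a :: w); split=> //; [apply/reduced_cons|apply: word_eq_refl].
have [s as_] := base_letter ab; case: w wr aw => [|b w] wr aw.
  by left; exists s.
have /reduced_cons[bw nb wr'] := wr.
have [c [cb c_base sbc]] := base_mul_letter s b.
right; exists (c :: w); split=> //.
  apply/reduced_cons; split=> //; first by rewrite (path_alternates _ cb).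
  by move=> /c_base.
apply: word_eq_trans (word_eq_catr w sbc).
exact: (word_eq_catr (b :: w) as_).
Qed.

Lemma word_reduced_form w : has_reduced_form w.
Proof.
elim: w => [|a w [[s ws]|[[|b v] [v0 vr wv]]]].
- left; exists 1; rewrite morph_one //; exact/word_eq_sym/word_eq_one1.
- have [c [_ ac]] : exists c, is_left c = is_left a /\
      weq [:: a; inl (i1 s)] [:: c].
    case: a => x; first exact: mul_letters.
    have [c [? xc]] := @mul_letters (inr x) (inr (i2 s)) erefl.
    exists c; split=> //; apply: word_eq_trans xc.
    exact: (word_eq_catl [:: inr x] (E_glue s)).
  apply: has_reduced_form_eq (has_reduced_form_cons (w := [::]) (a := c) _ _) => //.
  exact: word_eq_trans (word_eq_catl [:: a] ws) ac.
- by [].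
- apply: has_reduced_form_eq (word_eq_catl [:: a] wv) _.
  have /reduced_cons[bv nb vr'] := vr.
  have [ab|ab] := eqVneq (is_left a) (is_left b); last first.
    by apply: has_reduced_form_cons => //=; rewrite /alternates ab.
  have [c [ca abc]] := mul_letters ab.
  apply: has_reduced_form_eq (word_eq_catr v abc) (has_reduced_form_cons _ _) => //.
  by rewrite (path_alternates (b := b)) // ca.
Qed.

End ReducedWords.

(** * Separating finite sets *)

Lemma finite_set_ind (T : Type) (P : set T -> Prop) : P set0 ->
  (forall x A, finite_set A -> ~ A x -> P A -> P (x |` A)) ->
  forall A, finite_set A -> P A.
Proof.
move=> P0 PU A /(@finite_seqP {classic T})[s ->].
elim: s => [|x s IH]; first by rewrite [X in P X](_ : _ = set0) //; apply/seteqP; split.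
have -> : [set` x :: s] = x |` [set` s].
  apply/seteqP; split=> y /=; rewrite in_cons.
    by case/orP=> [/eqP|]; [left|right].
  by case=> [->|ys]; rewrite ?eqxx // ys orbT.
have [xs|xs] := pselect ([set` s] x).
  suff -> : x |` [set` s] = [set` s] by [].
  by apply/seteqP; split=> [y [->|]|y ys]//; right.
by apply: PU => //; apply: (@finite_seq {classic T}).
Qed.

Definition separated (G : groupType) (X : graph) (act : G -> X -> X) (x y : X) :=
  forall g, g <> 1 -> act g x <> y /\ ~ adj (act g x) y.

Definition same_type (X Y : graph) (x x' : X) (y y' : Y) :=
  (x = x' <-> y = y') /\ (adj x x' <-> adj y y').

Lemma same_type_sym (X Y : graph) (x x' : X) (y y' : Y) :
  same_type x x' y y' -> same_type x' x y' y.
Proof.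
move=> [e a]; split; first by split=> /esym/e.
by split=> /adj_sym/a/adj_sym.
Qed.

Lemma separated_sym (G : groupType) (X : graph) (act : G -> X -> X) x y :
  random_action act -> separated act x y -> separated act y x.
Proof.
move=> raX sep g g1; have [] := sep g^-1.
  by move=> /(congr1 (fun h => h^-1)); rewrite invgK invg1.
move=> ne na; split; first by move=> /(ract_eqV raX).
by move=> /(ract_adjV raX).
Qed.

(** For [s <> 1] separation makes everything false on both sides; the remaining case [s = 1] is
    [same_type]. *)
Lemma compatible_separated (S : groupType) (X Y : graph) (aX : S -> X -> X)
    (aY : S -> Y -> Y) r r' : random_action aX -> random_action aY ->
  separated aX r.1 r'.1 -> separated aY r.2 r'.2 ->
  same_type r.1 r'.1 r.2 r'.2 -> compatible aX aY r r'.
Proof.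
move=> raX raY sX sY st s; have [->|s1] := pselect (s = 1).
  by rewrite (ract1 raX) (ract1 raY).
by have [? ?] := sX s s1; have [? ?] := sY s s1.
Qed.

(** Each vertex is added in a new orbit. An edge from a nontrivial translate of it to an earlier
    image would make that image a nontrivial translate of an image, and an edge to [F] would put an
    image in the orbit of a point of [F]; induction excludes both. *)
Lemma scattered_copy (G : groupType) (X Y : graph) (act : G -> Y -> Y)
    (U : set X) (F : set Y) :
  random_action act -> finite_set U -> finite_set F ->
  exists f : X -> Y, (forall u, U u -> far act F (f u)) /\
    forall u u', U u -> U u' ->
      separated act (f u) (f u') /\ same_type u u' (f u) (f u').
Proof.
move=> raY Ufin Ffin; elim/finite_set_ind: U / Ufin => [|u0 A Afin Au0 [f [ffar fsep]]].
  by have [z _] := far_exists raY Ffin; exists (fun _ => z).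
pose T := f @` (A `&` [set u | adj u0 u]).
have [||z zP] := @ract_ext _ _ _ raY (F `|` f @` A) T.
- by rewrite finite_setU; split=> //; apply: finite_image.
- exact/finite_image/finite_setIl.
pose f' u := if `[< u = u0 >] then z else f u.
have f'0 : f' u0 = z by rewrite /f'; case: asboolP.
have f'A u : A u -> f' u = f u by rewrite /f'; case: asboolP => // ->.
have zf u : A u -> separated act z (f u) /\ same_type u0 u z (f u).
  move=> Au; have fu : (F `|` f @` A) (f u) by right; exists u.
  split=> [g g1|].
    have [ne ad] := zP g _ fu; split=> // /ad[v [Av _] /esym/(ract_eqV raY) fvu].
    have [_ /(_ Au Av)] := (ffar, fsep u v).
    have : g^-1 <> 1.
      by move=> /(congr1 (fun h => h^-1)); rewrite invgK invg1.
    move=> gV1 [sep _]; have [ne' _] := sep g^-1 gV1.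
    by apply: ne'; rewrite -fvu invgK (ractVK raY).
  have [] := zP 1 _ fu; rewrite invg1 !(ract1 raY) => ne ad; split.
    by split=> // u0u; case: Au0; rewrite u0u.
  split=> [u0u|/ad[v [Av u0v] fvu]]; first by apply/ad; exists u.
  by have [_ [/iffRL/(_ fvu) <-]] := fsep v u Av Au.
exists f'; split=> [u [->|Au]|u u' [->|Au] [->|Au']].
- rewrite f'0 => g y Fy; have [ne ad] := zP g y (or_introl Fy).
  split=> // /ad[v [Av _] fv].
  have [ne' _] := ffar v Av g y Fy; apply: ne'.
  by rewrite fv (ractKV raY).
- by rewrite f'A //; apply: ffar.
- rewrite f'0; split; last by split; split=> // /adj_irrefl.
  by move=> g g1; split; [move=> /(ract_free raY)|apply: ract_indep raY _ _].
- by rewrite f'0 f'A //; apply: zf.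
- rewrite f'0 f'A //; have [? ?] := zf u Au.
  by split; [apply: separated_sym|apply: same_type_sym].
- by rewrite !f'A //; apply: fsep.
Qed.

Section Separation.
Variables (S G : groupType) (X : graph) (act : G -> X -> X) (i : S -> G).
Hypothesis raX : random_action act.
Hypothesis loc_fin : forall u v, finite_set [set g | adj (act g u) v].
Hypotheses (iM : forall s t, i (s * t) = i s * i t) (i_inj : injective i).
Hypothesis Sfin : finite_set [set: S].
Hypothesis escape : forall F K : set G, finite_set F -> finite_set K -> ~ K 1 ->
  exists2 g, ~ F g & forall s, ~ K (g^-1 * i s * g).

(** By freeness and local finiteness, finitely many [g] make [g u] equal or adjacent to a given [v].
    Farness from [D] thus excludes finitely many [g], and separation asks the conjugates
    [g^-1 * i s * g] with [s <> 1] to avoid a finite set. *)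
Lemma separating_element (D U : set X) : finite_set D -> finite_set U ->
  exists g, (forall u, U u -> far (fun s => act (i s)) D (act g u)) /\
    forall u u', U u -> U u' ->
      separated (fun s => act (i s)) (act g u) (act g u').
Proof.
move=> Dfin Ufin; pose B u v := [set g | act g u = v \/ adj (act g u) v].
have Bfin u v : finite_set (B u v).
  rewrite [B u v](_ : _ = [set g | act g u = v] `|` [set g | adj (act g u) v]) //.
  rewrite finite_setU; split; last exact: loc_fin.
  have [[g gu]|no] := pselect (exists g, act g u = v).
    apply: sub_finite_set (finite_set1 g) => h /= hu.
    by apply: (ract_inj raX (x := u)); rewrite hu.
  by apply: sub_finite_set (finite_set0 _) => h hu; case: no; exists h.
(* Closing [D] under the finite group [S] turns a condition on [i s * g] into one on [g] alone. *)
pose D' := [set act (i s) d | s in [set: S] & d in D].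
have D'fin : finite_set D' by apply: finite_image2.
have BBfin (V W : set X) : finite_set V -> finite_set W ->
    finite_set (\bigcup_(r in V `*` W) B r.1 r.2).
  by move=> Vf Wf; apply: bigcup_finite => //; apply: finite_setX.
have [||g gF gK] := escape (BBfin _ _ Ufin D'fin)
    (K := (\bigcup_(r in U `*` U) B r.1 r.2) `\ 1).
- exact/finite_setD/BBfin.
- by case=> _ /(_ erefl).
exists g; split=> [u Uu s d Dd|u u' Uu Uu' s s1].
  have D's : D' (act (i s^-1) d) by exists s^-1 => //; exists d.
  rewrite morph_inv // in D's.
  split=> [/(ract_eqV raX) gu|/(ract_adjV raX)/adj_sym gu]; apply: gF.
    by exists (u, act (i s)^-1 d) => //; left.
  by exists (u, act (i s)^-1 d) => //; right.
have cE x : act (g^-1 * i s * g) x = act g^-1 (act (i s) (act g x)).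
  by rewrite !(ractM raX).
have c1 : g^-1 * i s * g <> 1.
  move=> e; apply: s1; apply: i_inj; rewrite morph_one //.
  by apply: (mulIg g); apply: (mulgI g^-1); rewrite mulgA e mul1g mulVg.
split=> e; apply: (gK s); split=> //; exists (u, u') => //; [left|right].
  by rewrite /= cE e (ractVK raX).
by rewrite /= cE -(ract_adj raX g) (ractKV raX).
Qed.

End Separation.

(** * Words acting through a partial isomorphism *)

Section AmalgamAction.
Variables (S G1 G2 : groupType) (i1 : S -> G1) (i2 : S -> G2).
Hypotheses (i1M : forall s t, i1 (s * t) = i1 s * i1 t)
           (i2M : forall s t, i2 (s * t) = i2 s * i2 t).
Hypotheses (i1_inj : injective i1) (i2_inj : injective i2).
Variables (X Y : graph) (a1 : G1 -> X -> X) (a2 : G2 -> Y -> Y).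
Hypotheses (ra1 : random_action a1) (ra2 : random_action a2).

Let b1 s := a1 (i1 s).
Let b2 s := a2 (i2 s).

Let rb1 : random_action b1 := random_action_res ra1 i1M i1_inj.
Let rb2 : random_action b2 := random_action_res ra2 i2M i2_inj.

Definition letter_act (alpha : X -> Y) (beta : Y -> X) (a : G1 + G2) (x : X) : X :=
  match a with inl g => a1 g x | inr h => beta (a2 h (alpha x)) end.

Definition word_act alpha beta (w : seq (G1 + G2)) (x : X) : X :=
  foldr (letter_act alpha beta) x w.

Lemma far_res (G : groupType) (Z : graph) (a : G -> Z -> Z) (i : S -> G) F z h :
  random_action a -> far a F z -> far (fun s => a (i s)) F (a h z).
Proof. by move=> ra zF s f Ff; rewrite -(ractM ra (i s)); exact: zF (i s * h) f Ff. Qed.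

(** An orbit contains no edge, and by freeness [z] is not in the [S]-orbit of [h z] when [h] lies
    outside the base; so [z] itself may join [F]. *)
Lemma far_step (G : groupType) (Z : graph) (a : G -> Z -> Z) (i : S -> G) F F' z h :
  (forall s t, i (s * t) = i s * i t) ->
  random_action a -> far a F z -> ~ range i h -> F' `<=` z |` F ->
  far (fun s => a (i s)) F' (a h z).
Proof.
move=> iM ra zF nh FF' s f /FF' [->|Ff]; last by have := far_res i h ra zF s Ff.
rewrite -(ractM ra); split; last exact: (ract_indep ra).
move=> /(ract_free ra) sh; case: nh; exists s^-1 => //.
by apply: (mulgI (i s)); rewrite -iM mulgV morph_one // sh.
Qed.

Lemma fst_insert (p : set (X * Y)) x y :
  fst @` ((x, y) |` p) `<=` x |` (fst @` p).
Proof. by move=> _ [r [->|pr] <-]; [left|right; exists r]. Qed.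

Lemma snd_insert (p : set (X * Y)) x y :
  snd @` ((x, y) |` p) `<=` y |` (snd @` p).
Proof. by move=> _ [r [->|pr] <-]; [left|right; exists r]. Qed.

(** Letters are applied from the head, as for [word_act] of the reversed word, so that induction on
    the list follows the trajectory. *)
Let run alpha beta l x := foldl (fun z a => letter_act alpha beta a z) x l.

(** The endpoint is forced by [q], whichever [alpha] and [beta] realize it. The start depends on
    them because it may be [beta y] for a [y] not matched yet. *)
Let ends_fresh p l (start : (X -> Y) -> (Y -> X) -> X) := exists q x',
  [/\ p `<=` q, partial_iso b1 b2 q, ~ (fst @` p) x' &
    forall alpha beta, realizes q alpha beta ->
      run alpha beta l (start alpha beta) = x'].

Lemma ends_fresh_insert p r l (start start' : (X -> Y) -> (Y -> X) -> X) a :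
  ends_fresh (r |` p) l start ->
  (forall alpha beta, alpha r.1 = r.2 -> beta r.2 = r.1 ->
     letter_act alpha beta a (start' alpha beta) = start alpha beta) ->
  ends_fresh p (a :: l) start'.
Proof.
move=> [q [x' [rpq qq x'r lq]]] e; exists q, x'; split=> //.
- by move=> r' pr'; apply: rpq; right.
- by case=> r' pr' x'E; apply: x'r; exists r' => //; right.
move=> alpha beta ab; rewrite /= e; first exact: lq.
all: have := ab r.1 r.2; rewrite -surjective_pairing => H.
all: by case: H => //; apply: rpq; left.
Qed.

(** A point of [Y] awaiting a letter of [G1] is matched with an [x] far from the domain under the
    whole of [G1]; the translate of [x] by a non-base letter is then far under [S], and awaits a
    letter of [G2]. The conjuncts are the two sides of this alternation. *)
Lemma fresh_run l : reduced i1 i2 l -> forall p, partial_iso b1 b2 p ->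
  (forall x, far b1 (fst @` p) x -> (if l is inl _ :: _ then False else True) ->
     ends_fresh p l (fun _ _ => x)) /\
  (forall y, far b2 (snd @` p) y -> (if l is inr _ :: _ then False else True) ->
     ends_fresh p l (fun _ beta => beta y)).
Proof.
elim: l => [|a l IH] lr p pp.
  have [pfin _] := pp; split=> [x xfar _|y yfar _].
    exists p, x; split=> //; move=> px.
    by have [] := xfar 1 x px; rewrite (ract1 rb1).
  have [x xfar] := far_exists ra1 (finite_image fst pfin).
  exists ((x, y) |` p), x; split.
  - by move=> r; right.
  - by apply: partial_iso_insert_far => // s; apply: (xfar (i1 s)).
  - by move=> px; have [] := xfar 1 x px; rewrite (ract1 ra1).
  - by move=> alpha beta ab; have [] := ab x y (or_introl erefl).
have [al na lr'] := (reduced_cons i1 i2 a l).1 lr.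
have [pfin _] := pp.
case: a al na lr => [g|h] al na lr; split=> // z zfar _.
  have [x xfar] := far_exists ra1 (finite_image fst pfin).
  have p'p : partial_iso b1 b2 ((x, z) |` p).
    by apply: partial_iso_insert_far => // s; apply: (xfar (i1 s)).
  apply: (ends_fresh_insert (r := (x, z)) (start := fun _ _ => a1 g x)).
    apply: (IH lr' _ p'p).1; last by case: (l) al => // -[].
    by apply: far_step (@fst_insert _ _ _).
  by move=> alpha beta /= _ ->.
have [y yfar] := far_exists ra2 (finite_image snd pfin).
have p'p : partial_iso b1 b2 ((z, y) |` p).
  by apply: partial_iso_insert_far => // s; apply: (yfar (i2 s)).
apply: (ends_fresh_insert (r := (z, y)) (start := fun _ beta => beta (a2 h y))).
  apply: (IH lr' _ p'p).2; last by case: (l) al => // -[].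
  by apply: far_step (@snd_insert _ _ _).
by move=> alpha beta /= -> _.
Qed.

(** The start [x] is put in the domain before the letters after the first are run, and the endpoint
    is forced outside that domain. *)
Lemma reduced_word_moves w p : w <> [::] -> reduced i1 i2 w ->
  partial_iso b1 b2 p -> exists q, [/\ p `<=` q, partial_iso b1 b2 q &
    forall alpha beta, realizes q alpha beta ->
      exists x, word_act alpha beta w x <> x].
Proof.
move=> w0 wr pp.
have lr : reduced i1 i2 (rev w).
  split; last by move=> a; rewrite mem_rev; apply: wr.2.
  rewrite rev_sorted; have := wr.1; congr (is_true (sorted _ w)).
  by apply/funext => a; apply/funext => b; rewrite /alternates eq_sym.
have actE alpha beta x : word_act alpha beta w x = run alpha beta (rev w) x.
  by rewrite /run foldl_rev.
have : rev w <> [::] by move=> /(congr1 rev); rewrite revK.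
case: (rev w) lr actE => // a l lr actE _.
have [pfin _] := pp.
have [x xfar] := far_exists ra1 (finite_image fst pfin).
have [y yfar] := far_exists ra2 (finite_image snd pfin).
have p'p : partial_iso b1 b2 ((x, y) |` p).
  apply: partial_iso_insert_far => // s; first exact: (xfar (i1 s)).
  exact: (yfar (i2 s)).
have [al na lr'] := (reduced_cons i1 i2 a l).1 lr.
have [start [lstart startE]] : exists start,
    ends_fresh ((x, y) |` p) l start /\ forall alpha beta, alpha x = y ->
      letter_act alpha beta a x = start alpha beta.
  case: a al na {lr actE} => [g|h] al na.
    exists (fun _ _ => a1 g x); split=> //.
    apply: (fresh_run lr' p'p).1; last by case: (l) al => // -[].
    by apply: far_step (@fst_insert _ _ _).
  exists (fun _ beta => beta (a2 h y)); split=> [|alpha beta /= -> //].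
  apply: (fresh_run lr' p'p).2; last by case: (l) al => // -[].
  by apply: far_step (@snd_insert _ _ _).
have [q [x' [pq qq x'p qx']]] := lstart.
exists q; split=> //; first by move=> r pr; apply: pq; right.
move=> alpha beta ab; exists x; rewrite actE /= startE; last first.
  by have [] := ab x y (pq _ (or_introl erefl)).
rewrite -/(run alpha beta l _) qx' // => x'x.
by apply: x'p; exists (x, y); [left|].
Qed.

(** An isomorphism between induced subgraphs, given by its graph so that the finite ones can be
    enumerated. *)
Definition matching (A : set (X * X)) : Prop :=
  forall r r', A r -> A r' -> same_type r.1 r'.1 r.2 r'.2.

Hypothesis loc_fin : forall u v, finite_set [set g | adj (a1 g u) v].
Hypothesis Sfin : finite_set [set: S].
Hypothesis escape : forall F K : set G1, finite_set F -> finite_set K -> ~ K 1 ->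
  exists2 g, ~ F g & forall s, ~ K (g^-1 * i1 s * g).
Hypothesis proper : exists h, ~ range i2 h.

Lemma matching_realized A p : finite_set A -> matching A ->
  partial_iso b1 b2 p -> exists q, [/\ p `<=` q, partial_iso b1 b2 q &
    forall alpha beta, realizes q alpha beta ->
      exists w, forall r, A r -> word_act alpha beta w r.1 = r.2].
Proof.
move=> Afin Am pp; have [pfin pc] := pp; have [h hS] := proper.
have Ufin := finite_image fst Afin; have Wfin := finite_image snd Afin.
have Dfin := finite_image fst pfin.
have [g [gfar gsep]] :=
  separating_element ra1 loc_fin i1M i1_inj Sfin escape Dfin Ufin.
(* Including the [g]-translate of the source keeps the [g']-translate of the target away from it
   too. *)
have D'fin : finite_set (fst @` p `|` a1 g @` (fst @` A)).
  by rewrite finite_setU; split=> //; apply: finite_image.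
have [g' [g'far g'sep]] :=
  separating_element ra1 loc_fin i1M i1_inj Sfin escape D'fin Wfin.
have [f [ffar fsep]] := scattered_copy ra2 Ufin (finite_image snd pfin).
have A1 r : A r -> (fst @` A) r.1 by exists r.
have A2 r : A r -> (snd @` A) r.2 by exists r.
have p1 r : p r -> (fst @` p) r.1 by exists r.
have p2 r : p r -> (snd @` p) r.2 by exists r.
(* [e] sends the [g]-translate of the source to its scattered copy; [e'] sends the [g']-translate of
   the target to the [h]-translate of that copy. *)
pose e (r : X * X) : X * Y := (a1 g r.1, f r.1).
pose e' (r : X * X) : X * Y := (a1 g' r.2, a2 h (f r.1)).
have b2_conj s r : a2 (h^-1 * i2 s * h) (f r) = a2 h^-1 (b2 s (a2 h (f r))).
  by rewrite !(ractM ra2).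
have ep r r' : A r -> p r' -> compatible b1 b2 (e r) r'.
  move=> Ar pr' s; have [? ?] := gfar _ (A1 _ Ar) s _ (p1 _ pr').
  by have [? ?] := ffar _ (A1 _ Ar) (i2 s) _ (p2 _ pr').
have e'p r r' : A r -> p r' -> compatible b1 b2 (e' r) r'.
  move=> Ar pr' s.
  have [? ?] := g'far _ (A2 _ Ar) s r'.1 (or_introl (p1 _ pr')).
  by have [] := ffar _ (A1 _ Ar) (i2 s * h) _ (p2 _ pr'); rewrite (ractM ra2).
have e'e r r' : A r -> A r' -> compatible b1 b2 (e' r) (e r').
  move=> Ar Ar' s.
  have [|? ?] := g'far _ (A2 _ Ar) s (a1 g r'.1).
    by right; exists r'.1 => //; apply: A1.
  have [sep _] := fsep _ _ (A1 _ Ar) (A1 _ Ar').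
  (* [i2 s * h] is never 1, as [h] lies outside the base, so the separation of the copy under all of
     [G2] applies. *)
  have [|] := sep (i2 s * h); last by rewrite (ractM ra2).
  move=> sh; apply: hS; exists s^-1 => //.
  by apply: (mulgI (i2 s)); rewrite -i2M mulgV morph_one // sh.
have ee r r' : A r -> A r' -> compatible b1 b2 (e r) (e r').
  move=> Ar Ar'; have [sep [te ta]] := fsep _ _ (A1 _ Ar) (A1 _ Ar').
  apply: compatible_separated => //=.
  - exact: gsep (A1 _ Ar) (A1 _ Ar').
  - by move=> s s1; apply: sep; rewrite -(morph_one i2M) => /i2_inj.
  - split; last exact: iff_trans (ract_adj ra1 _ _ _) ta.
    split=> [/(can_inj (ractVK ra1 _))/te //|/te ->//].
have e'e' r r' : A r -> A r' -> compatible b1 b2 (e' r) (e' r').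
  move=> Ar Ar'; have [sep [te ta]] := fsep _ _ (A1 _ Ar) (A1 _ Ar').
  have [me ma] := Am _ _ Ar Ar'.
  apply: compatible_separated => //=.
  - exact: g'sep (A2 _ Ar) (A2 _ Ar').
  - move=> s s1; have [|ne na] := sep (h^-1 * i2 s * h).
      move=> c1; apply: s1; apply: i2_inj; rewrite morph_one //.
      by apply: (mulIg h); apply: (mulgI h^-1); rewrite mulgA c1 mul1g mulVg.
    rewrite b2_conj in ne na; split=> [c|c].
      by apply: ne; rewrite c (ractVK ra2).
    by apply: na; rewrite -(ract_adj ra2 h) (ractKV ra2).
  - split; last first.
      apply: iff_trans (ract_adj ra1 _ _ _) _.
      exact: iff_trans (iff_sym ma) (iff_trans ta (iff_sym (ract_adj ra2 _ _ _))).
    split=> [/(can_inj (ractVK ra1 _))/me/te -> //|].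
    by move=> /(can_inj (ractVK ra2 _))/te/me ->.
exists (p `|` (e @` A `|` e' @` A)); split.
- by move=> r pr; left.
- split; first by rewrite !finite_setU; split=> //; split; apply: finite_image.
  move=> r1 r2 [pr|[[r Ar <-]|[r Ar <-]]] [pr'|[[r' Ar' <-]|[r' Ar' <-]]].
  + exact: pc.
  + by apply: compatible_sym => //; apply: ep.
  + by apply: compatible_sym => //; apply: e'p.
  + exact: ep.
  + exact: ee.
  + by apply: compatible_sym => //; apply: e'e.
  + exact: e'p.
  + exact: e'e.
  + exact: e'e'.
- move=> alpha beta ab; exists [:: inl g'^-1; inr h; inl g] => r Ar /=.
  have [-> _] : alpha (a1 g r.1) = f r.1 /\ beta (f r.1) = a1 g r.1.
    by apply: ab; right; left; exists r.
  have [_ ->] : alpha (a1 g' r.2) = a2 h (f r.1) /\ beta (a2 h (f r.1)) = a1 g' r.2.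
    by apply: ab; right; right; exists r.
  by rewrite (ractVK ra1).
Qed.

End AmalgamAction.

(** * Amalgams act homogeneously *)

Lemma countable_code (T : Type) : countable [set: T] -> exists c : T -> nat, injective c.
Proof.
move=> /countable_injP[c c_inj]; exists c => x y.
exact: c_inj (in_setT _) (in_setT _).
Qed.

Lemma code_countable (T : Type) (C : countType) (c : T -> C) :
  injective c -> countable [set: T].
Proof.
move=> c_inj; apply/countable_injP; exists (pickle \o c) => x y _ _ /= /(pcan_inj pickleK).
exact: c_inj.
Qed.

Lemma countable_finite_sets (T : Type) :
  countable [set: T] -> countable [set: {A : set T | finite_set A}].
Proof.
move=> /countable_finite_subset/countable_injP[c c_inj].
apply: (@code_countable _ nat (c \o sval)) => -[A Af] [B Bf] /= AB.
by apply: eq_exist; apply: c_inj AB; apply/mem_set; split.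
Qed.

(** [{perm 'I_0}] serves as the trivial group. *)
Lemma trivial_perm (s : {perm 'I_0}) : s = 1.
Proof. by apply/permP => -[]. Qed.

(** For the trivial group, [ract_ext] is the extension property of [R] for the parts of [F] inside
    and outside [T]. *)
Lemma random_graph_random_action (R : graph) : random_graph R ->
  random_action (fun (_ : {perm 'I_0}) (x : R) => x).
Proof.
move=> [_ ext]; split=> //.
- by move=> g x _; apply: trivial_perm.
- by move=> _ x; apply: adj_irrefl.
- move=> F T Ff Tf; have [||| z [zF zT zFT]] := ext (F `&` T) (F `\` T).
  + exact: finite_setIl.
  + exact: finite_setD.
  + by apply/seteqP; split=> x // [[_ ?] []].
  exists z => _ f Fx; have [Tx|Tx] := pselect (T f).
    split; first by move=> zf; apply: zF; left; rewrite zf.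
    by split=> // _; apply: zT.
  split; first by move=> zf; apply: zF; right; rewrite zf.
  by split=> // zf; case: (zFT f).
Qed.

Lemma in_HR_iso (X R : graph) (f : X -> R) (f' : R -> X) (G : groupType) :
  cancel f f' -> cancel f' f -> (forall x y, adj (f x) (f y) <-> adj x y) ->
  in_HR X G -> in_HR R G.
Proof.
move=> fK f'K fadj [cntG [act [[aut actM] act_inj act_hom]]]; split=> //.
have f'adj x y : adj (f' x) (f' y) <-> adj x y by rewrite -fadj !f'K.
exists (fun g x => f (act g (f' x))); split.
- split=> [g|g h]; last first.
    by apply/funext => x /=; rewrite fK actM.
  have [[k gK kK] gadj] := aut g; split.
    exists (fun x => f (k (f' x))) => x; first by rewrite fK gK f'K.
    by rewrite fK kK f'K.
  move=> x y; exact: iff_trans (fadj _ _) (iff_trans (gadj _ _) (f'adj _ _)).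
- move=> g h gh; apply: act_inj; apply/funext => x.
  by have /(congr1 f') := congr1 (fun k => k (f x)) gh; rewrite !fK.
- move=> U W phi Uf Wf [[phi_fun phi_inj phi_surj] phi_adj].
  have iso' : induced_iso (f' @` U) (f' @` W) (fun x => f' (phi (f x))).
    split; first split.
    - by move=> _ [u Uu <-]; rewrite f'K; exists (phi u) => //; apply: phi_fun.
    - move=> x y /set_mem[u Uu <-] /set_mem[v Uv <-]; rewrite !f'K.
      by move=> /(can_inj f'K)/phi_inj ->//; apply/mem_set.
    - move=> _ [w Ww <-]; have [u Uu <-] := phi_surj w Ww.
      by exists (f' u); [exists u|rewrite f'K].
    - move=> _ _ [u Uu <-] [v Uv <-]; rewrite !f'K.
      exact: iff_trans (f'adj _ _) (iff_trans (phi_adj _ _ Uu Uv) (iff_sym (f'adj _ _))).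
  have [g gP] := act_hom _ _ _ (finite_image f' Uf) (finite_image f' Wf) iso'.
  exists g => u Uu; rewrite gP; last by exists u.
  by rewrite f'K f'K.
Qed.

(** If no [g] works, each [g] outside [F] has some [k] of [K] in [g^-1 Sigma g]. The sets [Sk k] of
    such [g] form a finite cover, and [k] lies in the core over [Sk k]; a trivial core forces
    [k = 1], which [K] omits. *)
Lemma highly_core_free_escape (G : groupType) (Sigma : set G) :
  infinite_set [set: G] -> Sigma 1 -> highly_core_free Sigma ->
  forall F K : set G, finite_set F -> finite_set K -> ~ K 1 ->
  exists2 g, ~ F g & forall s, Sigma s -> ~ K (g^-1 * s * g).
Proof.
move=> Ginf S1 hcf F K Ff Kf K1; apply: contrapT => none.
pose Sk k := [set g | exists2 s, Sigma s & g^-1 * s * g = k].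
have cover g : ~ F g -> exists2 k, K k & Sk k g.
  move=> Fg; apply: contrapT => H; apply: none; exists g => // s Ss Kg.
  by apply: H; exists (g^-1 * s * g) => //; exists s.
have [t tE] : exists t : seq G, K `&` [set k | Sk k !=set0] = [set` t].
  exact/finite_seqP/finite_setIl.
have mem_t k g : K k -> Sk k g -> k \in t.
  move=> Kk kg; suff : [set` t] k by [].
  by rewrite -tE; split=> //; exists g.
have tK (k : 'I_(size t)) : [/\ K (tnth (in_tuple t) k) & Sk (tnth (in_tuple t) k) !=set0].
  have : [set` t] (tnth (in_tuple t) k) by apply: mem_tnth.
  by rewrite -tE => -[].
have [|k|g [_ gF]|k coreE] := hcf F (size t) (fun k => Sk (tnth (in_tuple t) k)) Ff.
(* The cover has at least one member, since [G] is infinite and [F] finite. *)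
- have [g [_ Fg]] := infinite_setN0 (infinite_setD Ginf Ff).
  by have [k Kk kg] := cover g Fg; have := mem_t k g Kk kg; case: (t).
- by have [] := tK k.
- have [|k Kk kg] := cover g.
    by move=> Fg; apply: gF; exists 1 => //; exists g => //; rewrite mul1g.
  have kt := mem_t k g Kk kg.
  have it : (index k t < size t)%N by rewrite index_mem.
  exists (Ordinal it) => //.
  by rewrite (tnth_nth 1) /= nth_index.
have [Kk _] := tK k; apply: K1.
suff : core (Sk (tnth (in_tuple t) k)) Sigma (tnth (in_tuple t) k).
  by rewrite coreE => <-.
by move=> h [s Ss hs]; exists s.
Qed.

(** A random action restricts to one of the trivial group, for which equivariance is no constraint:
    this is the classical back and forth. *)
Lemma random_graph_iso (X R : graph) (G : groupType) (act : G -> X -> X) :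
  random_action act -> countable [set: X] -> random_graph R ->
  exists (f : X -> R) (f' : R -> X), [/\ cancel f f', cancel f' f &
    forall x y, adj (f x) (f y) <-> adj x y].
Proof.
move=> raX cntX Rr; have raR := random_graph_random_action Rr.
have raX' : random_action (fun s : {perm 'I_0} => act ((fun=> 1) s)).
  apply: (random_action_res raX (i := fun=> 1)) => [s t|s t _]; first by rewrite mulg1.
  by rewrite (trivial_perm s) (trivial_perm t).
have cntR : countable [set: R] by rewrite (eq_countable Rr.1); apply: countableP.
have fin1 : finite_set [set: {perm 'I_0}] by apply: finite_finset.
have [||f [f' [fK f'K _ fadj _]]] :=
  @generic_iso _ _ _ _ _ raX' raR fin1 cntX cntR void (fun _ _ _ => True).
- exact: countableP.
- by case.
- by exists f, f'.
Qed.

(** * Free and amalgamated products treated together *)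

Section GluedProductInHR.
Variables (S : finGroupType) (G1 G2 : groupType) (E : set (G1 * G2)).
Variables (i1 : S -> G1) (i2 : S -> G2).
Hypotheses (i1M : forall s t, i1 (s * t) = i1 s * i1 t)
           (i2M : forall s t, i2 (s * t) = i2 s * i2 t).
Hypotheses (i1_inj : injective i1) (i2_inj : injective i2).
Hypothesis E_base : forall x y, E (x, y) -> exists s, x = i1 s /\ y = i2 s.
Hypothesis E_glue : forall s, word_eq E [:: inl (i1 s)] [:: inr (i2 s)].
Hypotheses (cnt1 : countable [set: G1]) (cnt2 : countable [set: G2]).
Hypothesis escape : forall F K : set G1, finite_set F -> finite_set K -> ~ K 1 ->
  exists2 g, ~ F g & forall s, ~ K (g^-1 * i1 s * g).
Hypothesis proper : exists h, ~ range i2 h.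

Lemma countable_words : countable [set: seq (G1 + G2)].
Proof.
have [c1 c1_inj] := countable_code cnt1; have [c2 c2_inj] := countable_code cnt2.
pose c (a : G1 + G2) : nat + nat :=
  match a with inl x => inl (c1 x) | inr y => inr (c2 y) end.
have c_inj : injective c by move=> [x|x] [y|y] // [] => [/c1_inj|/c2_inj] ->.
exact: (code_countable (inj_map c_inj)).
Qed.

Lemma countable_glued_prod : countable [set: glued_prod E].
Proof.
have [c c_inj] := countable_code countable_words.
apply: (@code_countable _ nat (c \o @glued_word _ _ E)) => x y /c_inj xy.
by rewrite -[x]glued_wordK xy glued_wordK.
Qed.

Section Action.
Variables (X Y : graph) (a1 : G1 -> X -> X) (a2 : G2 -> Y -> Y).
Hypotheses (ra1 : random_action a1) (ra2 : random_action a2).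
Variables (alpha : X -> Y) (beta : Y -> X).
Hypotheses (alphaK : cancel alpha beta) (betaK : cancel beta alpha).
Hypothesis alpha_equiv : forall s x, alpha (a1 (i1 s) x) = a2 (i2 s) (alpha x).
Hypothesis alpha_adj : forall x x', adj (alpha x) (alpha x') <-> adj x x'.

Local Notation wact := (word_act a1 a2 alpha beta).

Lemma word_act_cat v w x : wact (v ++ w) x = wact v (wact w x).
Proof. by rewrite /word_act foldr_cat. Qed.

Lemma word_act_eq v w : word_eq E v w -> wact v =1 wact w.
Proof.
elim=> {v w} [w|v w _ IH|u v w _ IH1 _ IH2|v v' w w' _ IH1 _ IH2||| x y|x y|x y /E_base[s [-> ->]]] z //=.
- by rewrite IH1 IH2.
- by rewrite !word_act_cat IH2 IH1.
- by rewrite (ract1 ra1).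
- by rewrite (ract1 ra2) alphaK.
- by rewrite (ractM ra1).
- by rewrite betaK (ractM ra2).
- by rewrite -alpha_equiv alphaK.
Qed.

Lemma word_act_adj w x y : adj (wact w x) (wact w y) <-> adj x y.
Proof.
elim: w => [|a w IH] //=; apply: iff_trans IH; case: a => [g|h] /=.
  exact: ract_adj.
by rewrite -alpha_adj !betaK; apply: iff_trans (ract_adj ra2 _ _ _) (alpha_adj _ _).
Qed.

Definition glued_act (g : glued_prod E) : X -> X := wact (glued_word g).

Lemma glued_act_class w : glued_act (glued_class E w) =1 wact w.
Proof. exact/word_act_eq/glued_class_word. Qed.

Lemma glued_actM g h : glued_act (g * h) = glued_act g \o glued_act h.
Proof. by apply/funext => x /=; rewrite glued_act_class word_act_cat. Qed.

Lemma glued_act_action : graph_action glued_act.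
Proof.
have act1 : glued_act 1 =1 id by move=> x; rewrite glued_act_class.
split=> [g|]; last exact: glued_actM.
split; last exact: word_act_adj.
exists (glued_act g^-1) => x; rewrite -[LHS](congr1 (fun f => f x) (glued_actM _ _)).
  by rewrite mulVg act1.
by rewrite mulgV act1.
Qed.

(** An element acting trivially cannot equal a non-empty reduced word, so it is a base element; as
    it fixes [x0], freeness makes it 1. *)
Lemma glued_act_faithful (x0 : X) :
  (forall w, w <> [::] -> reduced i1 i2 w -> exists x, wact w x <> x) ->
  faithful_action glued_act.
Proof.
move=> moves g h gh.
have triv k : glued_act k =1 id -> k = 1.
  rewrite -[k]glued_wordK => kid.
  have kact x : wact (glued_word k) x = x by rewrite -glued_act_class kid.
  apply/glued_classP.
  have [[s ks]|[w' [w'0 w'r kw']]] := word_reduced_form i1M i2M E_glue (glued_word k).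
    apply: (word_eq_trans ks _); have := kact x0; rewrite (word_act_eq ks) /=.
    by move=> /(ract_free ra1) ->; apply: word_eq_one1.
  have [x []] := moves w' w'0 w'r.
  by rewrite -(word_act_eq kw') kact.
apply: (mulgI h^-1); rewrite mulVg; apply: triv => x.
rewrite glued_actM /= gh -[LHS](congr1 (fun f => f x) (glued_actM _ _)) mulVg.
by rewrite glued_act_class.
Qed.

End Action.

Lemma glued_prod_in_HR (R : graph) : random_graph R -> in_HR R (glued_prod E).
Proof.
move=> Rr; have [c1 c1_inj] := countable_code cnt1; have [c2 c2_inj] := countable_code cnt2.
have ra1 := translation_random_action c1_inj; have ra2 := translation_random_action c2_inj.
set X := orbit_graph c1 in ra1; set Y := orbit_graph c2 in ra2.
have cntX : countable [set: X].
  apply: (@code_countable _ (nat * nat)%type (fun x => (c1 x.1, x.2))).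
  by move=> [g n] [h m] [/c1_inj -> ->].
have cntY : countable [set: Y].
  apply: (@code_countable _ (nat * nat)%type (fun x => (c2 x.1, x.2))).
  by move=> [g n] [h m] [/c2_inj -> ->].
have Sfin : finite_set [set: S] by apply: finite_finset.
have rb1 := random_action_res ra1 i1M i1_inj.
have rb2 := random_action_res ra2 i2M i2_inj.
(* The requirements on [alpha]: finite matchings give homogeneity, reduced words give
   faithfulness. *)
pose I := ({A : set (X * X) | finite_set A} + seq (G1 + G2))%type.
pose P (k : I) (alpha : X -> Y) (beta : Y -> X) : Prop := match k with
  | inl A => matching (sval A) ->
      exists w : seq (G1 + G2), forall r, sval A r ->
        word_act (@translation _ c1) (@translation _ c2) alpha beta w r.1 = r.2
  | inr w => w <> [::] -> reduced i1 i2 w ->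
      exists x, word_act (@translation _ c1) (@translation _ c2) alpha beta w x <> x end.
have cntI : countable [set: I].
  have cntXX : countable [set: X * X] by rewrite -setXTT; apply: countableX.
  have [cA cA_inj] := countable_code (countable_finite_sets cntXX).
  have [cw cw_inj] := countable_code countable_words.
  apply: (@code_countable _ (nat + nat)%type (fun k : I =>
    match k with inl A => inl (cA A) | inr w => inr (cw w) end)).
  by move=> [x|x] [y|y] // [] => [/cA_inj|/cw_inj] ->.
have [|alpha [beta [alphaK betaK alpha_equiv alpha_adj Pall]]] :=
    generic_iso rb1 rb2 Sfin cntX cntY (P := P) cntI.
  case=> [[A Af]|w] p pp /=.
    have [Am|nAm] := pselect (matching A); last by exists p; split.
    have [q [pq qq qP]] := matching_realized i1M i2M i1_inj i2_inj ra1 ra2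
      (translation_locally_finite c1_inj) Sfin escape proper Af Am pp.
    by exists q; split=> // al be _ _ /qP.
  have [[w0 wr]|nw] := pselect (w <> [::] /\ reduced i1 i2 w); last first.
    by exists p; split=> // al be _ _ _ w0 wr; case: nw.
  have [q [pq qq qP]] := reduced_word_moves i1M i2M i1_inj i2_inj ra1 ra2 w0 wr pp.
  by exists q; split=> // al be _ _ /qP.
have [f [f' [fK f'K fadj]]] := random_graph_iso ra1 cntX Rr.
apply: (in_HR_iso fK f'K fadj); split; first exact: countable_glued_prod.
exists (glued_act (@translation _ c1) (@translation _ c2) alpha beta); split.
- exact: glued_act_action.
- apply: glued_act_faithful => //; first exact: (1, 0).
  by move=> w w0 wr; apply: (Pall (inr w)).
- move=> U W phi Uf Wf [[_ phi_inj _] phi_adj].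
  pose A : set (X * X) := (fun u => (u, phi u)) @` U.
  have [|w wP] := Pall (inl (exist _ A (finite_image _ Uf))).
    move=> _ _ [u Uu <-] [v Uv <-]; split=> /=; last exact: iff_sym (phi_adj _ _ Uu Uv).
    by split=> [->//|]; apply: phi_inj; apply/mem_set.
  exists (glued_class E w) => u Uu; rewrite glued_act_class //.
  by apply: (wP (u, phi u)); exists u.
Qed.

End GluedProductInHR.

Theorem theoremA (R : graph) (hR : random_graph R) (G1 G2 : groupType)
    (ntriv1 : exists x : G1, x <> 1) (ntriv2 : exists x : G2, x <> 1)
    (cnt1 : countable [set: G1]) (cnt2 : countable [set: G2])
    (inf1 : infinite_set [set: G1]) :
  in_HR R (free_product G1 G2) /\
  forall (S : finGroupType)
         (i1 : {multiplicative S -> G1}) (i2 : {multiplicative S -> G2}),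
    injective i1 -> injective i2 ->
    highly_core_free (range i1) ->
    (infinite_set [set: G2] /\ highly_core_free (range i2)) \/
    (finite_set [set: G2] /\ index_ge 2 (range i2)) ->
    in_HR R (amalgamated_product i1 i2).
Proof.
split=> [|S i1 i2 i1_inj i2_inj hcf1 hyp2].
  (* The free product is the amalgam over the trivial group. *)
  pose j (G : groupType) (_ : {perm 'I_0}) : G := 1.
  have jM (G : groupType) s t : j G (s * t) = j G s * j G t by rewrite /j mulg1.
  have j_inj (G : groupType) : injective (j G).
    by move=> s t _; rewrite (trivial_perm s) (trivial_perm t).
  apply: (glued_prod_in_HR (jM G1) (jM G2) (@j_inj G1) (@j_inj G2)) => //.
  - move=> s; apply: word_eq_trans (word_eq_one1 _) _.
    exact/word_eq_sym/word_eq_one2.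
  (* Conjugates of 1 are 1, which [K] omits, so any [g] outside [F] will do. *)
  - move=> F K Ff Kf K1; have [g [_ Fg]] := infinite_setN0 (infinite_setD inf1 Ff).
    by exists g => // s; rewrite /j mulg1 mulVg.
  - have [h h1] := ntriv2; exists h => -[s _ e].
    exact: h1 (esym e).
have i1M s t : i1 (s * t) = i1 s * i1 t by apply: gmulfM.
have i2M s t : i2 (s * t) = i2 s * i2 t by apply: gmulfM.
apply: (glued_prod_in_HR i1M i2M) => //.
- by move=> x y [s _ [<- <-]]; exists s.
- by move=> s; apply: word_eq_glue; exists s.
- move=> F K Ff Kf K1.
  have [|g Fg gK] := highly_core_free_escape inf1 _ hcf1 Ff Kf K1.
    by exists 1; rewrite ?morph_one.
  by exists g => // s; apply: gK; exists s.
- case: hyp2 => [[inf2 _]|[_ idx2]].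
    have [h [_ hS]] := infinite_setN0 (infinite_setD inf2
      (finite_image i2 (finite_finset (X := [set: S])))).
    by exists h.
  (* Without an element outside the base there would be a single coset, against index at least 2. *)
  apply: contrapT => all_base; have onto g : range i2 g.
    by apply: contrapT => ?; apply: all_base; exists g.
  have one_coset : left_cosets (range i2) `<=` [set range i2].
    move=> C [g _ <-]; apply/seteqP; split=> h _ /=; first exact: onto.
    by exists (g^-1 * h); rewrite ?mulKVg //; apply: onto.
  have := card_le_trans idx2 (subset_card_le one_coset).
  by rewrite (card_le_eqr card_set1) card_le_II.
Qed.
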